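(* Let $\mathbb{K}$ be a field, let $n\ge 1$, and let $\mathcal{X}\subseteq \mathrm{Mat}(n,\mathbb{K})$ be the set of $n\times n$ X-matrices over $\mathbb{K}$. Let $\mathcal{X}^\times=\{A\in\mathcal{X} : \text{there exists } B\in\mathcal{X} \text{ such that } AB=BA=I\}$. Then $\mathcal{X}^\times=\mathrm{GL}(n,\mathbb{K})\cap\mathcal{X}$.
   Context: $\mathrm{Mat}(n,\mathbb{K})$ is the ring of $n\times n$ matrices with entries in the field $\mathbb{K}$, and $\mathrm{GL}(n,\mathbb{K})$ is its group of invertible elements. A matrix $A=(a_{i,j})\in\mathrm{Mat}(n,\mathbb{K})$ is an X-matrix if $a_{i,j}=0$ whenever $i\neq j$ and $i+j\neq n+1$. $I$ denotes the identity matrix. *)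

(* Defs.v *)
From mathcomp Require Import all_boot all_order all_algebra.
From mathcomp Require Import classical_sets.

Set Implicit Arguments.
Unset Strict Implicit.
Unset Printing Implicit Defensive.

Import GRing.Theory.
Local Open Scope classical_set_scope.
Local Open Scope ring_scope.

(* Ordinals count from 0, so the 1-based row and column numbers are
   [i.+1] and [j.+1]. *)
Definition is_Xmx (K : fieldType) (n : nat) (A : 'M[K]_n) : Prop :=
  forall i j : 'I_n, i <> j -> (i.+1 + j.+1)%N <> n.+1 -> A i j = 0.

Definition Xmx (K : fieldType) (n : nat) : set 'M[K]_n :=
  [set A | is_Xmx A].
Arguments Xmx : clear implicits.

(* MathComp equips ['M[K]_n] with a unit ring structure only when [n] is a
   syntactic successor; [*m], [1%:M] and [unitmx] are the corresponding
   multiplication, identity and units for arbitrary [n]. *)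
Definition Xmx_units (K : fieldType) (n : nat) : set 'M[K]_n :=
  [set A | Xmx K n A /\
     exists B : 'M[K]_n, [/\ Xmx K n B, A *m B = 1%:M & B *m A = 1%:M]].
Arguments Xmx_units : clear implicits.

Definition GLset (K : fieldType) (n : nat) : set 'M[K]_n :=
  [set A | A \in unitmx].
Arguments GLset : clear implicits.

(* Main.v *)
Require Import Defs.
From mathcomp Require Import all_boot all_order all_algebra.
From mathcomp Require Import classical_sets.

(** The positions allowed to be nonzero in an X-matrix are those [(i, j)] with
    [j] in the orbit of [i] under the reversal [i |-> n+1-i].  So X-matrices are,
    up to reordering the basis, the matrices that are block diagonal for the
    partition of the indices into these orbits, that is, the centralizer of the
    coordinate projections onto the orbits ([is_XmxP]).  A centralizer contains
    the inverse of each of its invertible elements ([invmx_comm]), hence an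
    X-matrix that is invertible among all matrices has an X-matrix as its
    inverse. *)

Local Open Scope classical_set_scope.
Local Open Scope ring_scope.

Import GRing.Theory.

Definition rev_orbit (n : nat) (k i : 'I_n) : bool :=
  (i == k) || (i == rev_ord k).

Definition orbit_proj (K : fieldType) (n : nat) (k : 'I_n) : 'M[K]_n :=
  diag_mx (\row_i (rev_orbit n k i)%:R).

Lemma rev_ordP (n : nat) (i j : 'I_n) :
  (i.+1 + j.+1)%N = n.+1 <-> j = rev_ord i.
Proof.
have /= lt_in := ltn_ord i.
split=> [eq_ij | ->]; last by rewrite /= addnS subnKC.
apply: val_inj => /=; apply: (@addnI i.+1).
by rewrite subnKC //; move: eq_ij; rewrite addnS => -[].
Qed.

Lemma rev_orbit_rev (n : nat) (k i : 'I_n) :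
  rev_orbit n k (rev_ord i) = rev_orbit n k i.
Proof.
by rewrite /rev_orbit (inj_eq rev_ord_inj) (can2_eq rev_ordK rev_ordK) orbC.
Qed.

(** Commuting with a diagonal matrix of entries [d] means
    [A i j * d j = d i * A i j].  With the projection onto the orbit of [i],
    this kills [A i j] for [j] outside that orbit; conversely [d i = d j] for
    every projection when [i] and [j] share an orbit. *)
Lemma is_XmxP (K : fieldType) (n : nat) (A : 'M[K]_n) :
  is_Xmx A <-> forall k, comm_mx A (orbit_proj K n k).
Proof.
have entryE k i j :
    (A *m orbit_proj K n k) i j = A i j * (rev_orbit n k j)%:R /\
    (orbit_proj K n k *m A) i j = (rev_orbit n k i)%:R * A i j.
  by rewrite mul_mx_diag mul_diag_mx !mxE.
split=> [XA k | commA i j neq_ij neq_anti].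
  apply/matrixP=> i j; have [-> ->] := entryE k i j; rewrite mulrC.
  have [-> //|/eqP neq_ij] := eqVneq i j.
  have [->|/eqP neq_rev] := eqVneq j (rev_ord i).
    by rewrite rev_orbit_rev.
  by rewrite XA ?mulr0 // => /rev_ordP.
have [e1 e2] := entryE i i j.
move: e2; rewrite -commA e1 /rev_orbit eqxx mul1r => <-.
have /negPf-> : j != i by apply/eqP=> eq_ji; apply: neq_ij.
have /negPf-> : j != rev_ord i by apply/eqP=> /rev_ordP.
by rewrite mulr0.
Qed.

Lemma invmx_comm (K : fieldType) (n : nat) (A P : 'M[K]_n) :
  A \in unitmx -> comm_mx A P -> comm_mx (invmx A) P.
Proof.
rewrite /comm_mx => uA cAP.
by rewrite -[in LHS](mulmxK uA P) -cAP -mulmxA mulKmx.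
Qed.

Theorem proposition17 (K : fieldType) (n : nat) (hn : (1 <= n)%N) :
  Xmx_units K n = GLset K n `&` Xmx K n.
Proof.
apply/seteqP; split=> A.
  by case=> XA [B [_ /mulmx1_unit[uA _] _]]; split.
case=> uA XA; split=> //; exists (invmx A); split.
- have [cX _] := is_XmxP K n A; have [_ Xc] := is_XmxP K n (invmx A).
  by apply: Xc => k; apply: invmx_comm => //; apply: cX.
- exact: mulmxV.
- exact: mulVmx.
Qed.
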